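(* Let $G$ be a finite self-complementary symmetric graph of order $n=p^r$ ($p$ prime). Then $\overline{G}\in\mathcal{C}G$ if and only if $n=1$ or $n\equiv 5\pmod 8$.
   Context: A graph is self-complementary if it is isomorphic to its complement $\overline{G}$, and symmetric if it is vertex-transitive and edge-transitive. For a simple graph $G$ and $u\in V(G)$, $Gu$ is the graph with edge set $E(G)\triangle\{[x,y]:x\ne y,\ x,y\in N_G(u)\}$; for a word $s=u_1\cdots u_k$, $Gs=(\cdots(Gu_1)\cdots)u_k$. The complementation class of $G$ is $\mathcal{C}G=\{Gs: s \text{ a word over } V(G)\}$ (graphs on the same labelled vertex set; $\overline{G}\in\mathcal CG$ means equality, not isomorphism). *)

(* Defs.v *)
(* A simple graph is a symmetric irreflexive [e : rel T] on
   the vertex type [T : finType]; equality of graphs on [T] is [=2]. *)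
From mathcomp Require Import all_boot.

Set Implicit Arguments.
Unset Strict Implicit.
Unset Printing Implicit Defensive.

Definition graph_iso (T1 T2 : finType) (e1 : rel T1) (e2 : rel T2) : Prop :=
  exists2 f : T1 -> T2, bijective f & forall x y, e2 (f x) (f y) = e1 x y.

Definition graph_compl (T : finType) (e : rel T) : rel T :=
  fun x y => (x != y) && ~~ e x y.

Definition self_complementary (T : finType) (e : rel T) : Prop :=
  graph_iso e (graph_compl e).

Definition graph_aut (T : finType) (e : rel T) (f : T -> T) : Prop :=
  bijective f /\ forall x y, e (f x) (f y) = e x y.

Definition vertex_transitive (T : finType) (e : rel T) : Prop :=
  forall x y : T, exists2 f : T -> T, graph_aut e f & f x = y.

(* Edges are unordered pairs: the automorphism may reverse the edge. *)
Definition edge_transitive (T : finType) (e : rel T) : Prop :=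
  forall x y u v : T, e x y -> e u v ->
  exists2 f : T -> T, graph_aut e f & [set f x; f y] = [set u; v].

Definition symmetric_graph (T : finType) (e : rel T) : Prop :=
  vertex_transitive e /\ edge_transitive e.

(* [(+)] is the symmetric difference of the edge sets. *)
Definition local_compl (T : finType) (e : rel T) (u : T) : rel T :=
  fun x y => e x y (+) [&& x != y, e u x & e u y].

Definition local_compl_word (T : finType) (e : rel T) (s : seq T) : rel T :=
  foldl (@local_compl T) e s.

Definition in_compl_class (T : finType) (e e' : rel T) : Prop :=
  exists s : seq T, e' =2 local_compl_word e s.

(* Main.v *)
(* Over GF(2), a word of local complementations turns the adjacency matrix A
   into B if and only if (X + A Z) B = Y + A T for some diagonal matrices with
   XT + YZ = I (Bouchet). A self-complementary symmetric graph of order n is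
   strongly regular with parameters (4m + 1, 2m, m - 1, m), so that
   A^2 = A + m (I + J) and AJ = 0 over GF(2). For B = A + I + J, constant
   matrices solve the system when m is odd; when m is even the system forces
   A = I + J, so that m = 0. *)
Require Import Defs.
From mathcomp Require Import all_boot.
From mathcomp Require Import zify.

Set Implicit Arguments.
Unset Strict Implicit.
Unset Printing Implicit Defensive.

(** * Local complementation as symplectic maps over GF(2) *)

Section LocalComplementation.
Variable T : finType.
Implicit Types (e f : rel T) (x y z t : T -> bool).

Lemma local_compl_sym e v : symmetric e -> symmetric (local_compl e v).
Proof.
by move=> es a b; rewrite /local_compl es eq_sym; do 2!case: (e v _).
Qed.

Lemma local_compl_irr e v : irreflexive e -> irreflexive (local_compl e v).
Proof. by move=> ei a; rewrite /local_compl ei eqxx. Qed.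

Lemma local_complK e v : symmetric e -> irreflexive e ->
  local_compl (local_compl e v) v =2 e.
Proof.
move=> es ei a b; rewrite /local_compl ei !andbF !addbF.
by rewrite -addbA addbb addbF.
Qed.

(* The new equation at a neighbour [w] of [v] is the sum of the old ones at [w]
   and [v]; at the other vertices the equation does not change. *)
Lemma addb_local_compl e v (p q : T -> bool) : symmetric e -> irreflexive e ->
    (forall w, p w (+) \big[addb/false]_u (e w u && q u) = false) ->
  forall w, (p w (+) (e v w && q w))
    (+) \big[addb/false]_u (local_compl e v w u && (q u (+) ((u == v) && p u)))
    = false.
Proof.
move=> es ei H w.
have Hd u : e w u && (q u (+) ((u == v) && p u)) =
            (e w u && q u) (+) ((u == v) && (e w v && p v)).
  by case: eqP => [->|_] /=; case: (e w _); case: (q _); case: (p _).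
have sumd a b : \big[addb/false]_u ((u == a) && b) = b.
  by rewrite (bigD1 a) //= eqxx big1 ?addbF // => i /negPf ->.
case evw: (e v w); last first.
  rewrite (eq_bigr (fun u => e w u && q u)) ?addbF ?H // => u _.
  rewrite /local_compl evw andbF addbF Hd.
  by rewrite [e w v]es evw andbF addbF.
have ewv : e w v by rewrite es.
(* The new row at [w] is the sum of rows [w] and [v], except that no loop arises at [u = w]; the
   term at [u = v] comes from the change of [q v]. *)
rewrite (eq_bigr (fun u => ((e w u && q u) (+) ((u == v) && p v)) (+)
   ((e v u && q u) (+) ((u == w) && q w)))); last first.
  move=> u _; rewrite /local_compl evw /=.
  have vw : v == w = false by apply: contraTF evw => /eqP->; rewrite ei.
  have [->|_] := eqVneq u v; first by rewrite ewv ei vw andbF /= !addbF.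
  rewrite /= !addbF (eq_sym w).
  have [->|_] := eqVneq u w; rewrite ?ei ?evw /= ?addbb //.
  by case: (e w u); case: (e v u); case: (q u).
rewrite !big_split /= !sumd.
move: (H w) (H v).
move: (\big[addb/false]_u (e w u && q u)) => sw.
move: (\big[addb/false]_u (e v u && q u)) => sv.
by case: sw; case: sv; case: (p w); case: (p v); case: (q w).
Qed.

(* [x; y; z; t] are the diagonals of X, Y, Z, T in GF(2)-matrices such that
   (X + A Z) B = Y + A T with XT + YZ = I, where A and B are the adjacency
   matrices of [e] and [f]: a coordinatewise symplectic map carrying the row
   space of (I | A) onto that of (I | B). *)
Definition local_map e f x y z t : Prop :=
  (forall v, (x v && t v) (+) (y v && z v)) /\
  forall c w, ((x w && f w c) (+) (y w && (w == c))) (+)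
    \big[addb/false]_u (e w u && ((z u && f u c) (+) (t u && (u == c)))) = false.

Lemma eq_local_map e e' f x y z t : e =2 e' ->
  local_map e f x y z t -> local_map e' f x y z t.
Proof.
move=> ee' [D H]; split=> // c w; rewrite -[RHS](H c w).
by congr addb; apply: eq_bigr => u _; rewrite ee'.
Qed.

(** Apply [addb_local_compl] to each column of XB + Y and ZB + T. As [v] has no loop, each vertex
    undergoes at most one shear, so XT + YZ = I persists. *)
Lemma local_map_step e f v x y z t : symmetric e -> irreflexive e ->
    local_map e f x y z t ->
  local_map (local_compl e v) f
    (fun u => x u (+) (e v u && z u)) (fun u => y u (+) (e v u && t u))
    (fun u => z u (+) ((u == v) && x u)) (fun u => t u (+) ((u == v) && y u)).
Proof.
move=> es ei [D H]; split=> [u | c w].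
  have := D u; have [->|_] := eqVneq u v; rewrite ?ei /=.
    by case: (x v); case: (y v); case: (z v); case: (t v).
  by rewrite !addbF; case: (e v u); case: (x u); case: (y u); case: (z u); case: (t u).
rewrite -[RHS](addb_local_compl v es ei (H c) w); congr addb.
  by case: (e v w); case: (x w); case: (y w); case: (z w); case: (t w);
     case: (f w c); case: (w == c).
apply: eq_bigr => u _; congr andb.
by case: (u == v); case: (x u); case: (y u); case: (z u); case: (t u);
   case: (f u c); case: (u == c).
Qed.

(** Induction on the word: complementing twice at its first letter [v] gives [e] back, so a step at
    [v] carries a map for [local_compl e v] to one for [e]. *)
Lemma local_map_word e s : symmetric e -> irreflexive e ->
  exists x y z t, local_map e (local_compl_word e s) x y z t.
Proof.
elim: s e => [|v s IHs] e es ei.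
  exists xpredT, xpred0, xpred0, xpredT; split=> // c w /=.
  rewrite addbF (bigD1 c) //= eqxx andbT big1 ?addbF ?addbb // => u /negPf ->.
  by rewrite andbF.
have [x [y [z [t]]]] := IHs _ (local_compl_sym v es) (local_compl_irr v ei).
move/(local_map_step v (local_compl_sym v es) (local_compl_irr v ei)).
move/(eq_local_map (local_complK v es ei)) => H.
by do 4!eexists; exact: H.
Qed.

(* The proof applies local complementations to [e] until [z] vanishes, which
   forces [e = f]. One at [v] clears [z v] when [x v] also holds; otherwise the
   equation of row [v] provides a neighbour [w] with [z w], and
   complementing at [w] makes [x v] true without changing [z]. *)
Lemma local_map_in_class e f x y z t : symmetric e -> irreflexive e ->
  irreflexive f -> local_map e f x y z t -> in_compl_class e f.
Proof.
move=> es ei fi; have [n] := ubnP #|z|.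
elim: n e es ei x y z t => // n IHn e es ei x y z t zn H.
have shrink e' x' y' z' t' v : symmetric e' -> irreflexive e' ->
    #|z'| <= n -> z' v -> x' v -> local_map e' f x' y' z' t' ->
    in_compl_class e' f.
  move=> es' ei' zn' zv xv /(local_map_step v es' ei') H'.
  have [|s Hs] := IHn _ (local_compl_sym v es') (local_compl_irr v ei') _ _ _ _ _ H'.
    apply: leq_trans zn'; apply: proper_card; apply/properP; split.
      apply/subsetP => u; rewrite !unfold_in.
      by have [->|] := eqVneq u v; rewrite ?zv // addbF.
    by exists v; rewrite !unfold_in ?zv // eqxx xv.
  by exists (v :: s).
rewrite ltnS in zn.
have [z0|[v zv]] : (z =1 xpred0) \/ exists v, z v.
  by case: (pickP z) => [v|]; [right; exists v | left].
  case: H => D H; exists [::] => a b /=.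
  have tE u : t u by have := D u; rewrite z0 andbF addbF; case/andP.
  have xE u : x u by have := D u; rewrite z0 andbF addbF; case/andP.
  have [->|ab] := eqVneq a b; first by rewrite ei fi.
  have := H b a; rewrite xE (negPf ab) andbF addbF (bigD1 b) //= z0 tE eqxx andbT.
  rewrite big1 ?addbF; last by move=> u /negPf ->; rewrite z0 !andbF.
  by case: (f a b); case: (e a b).
case xv: (x v); first exact: (shrink _ _ _ _ _ v _ _ _ _ _ H).
have [D E] := H.
have yv : y v by have := D v; rewrite xv zv /= andbT.
(* In entry (v, v) the T term vanishes for lack of loops, so the sum over Z must cancel [y v]. *)
have [w /andP[vw zw]] : exists w, e v w && z w.
  apply/existsP; apply: contraT; rewrite negb_exists => /forallP nz.
  have := E v v; rewrite xv yv eqxx big1 //= => u _.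
  have := nz u; case evu: (e v u) => //= /negPf ->.
  have [uv|] := eqVneq u v; last by rewrite andbF.
  by rewrite uv ei in evu.
case xw: (x w); first exact: (shrink _ _ _ _ _ w _ _ _ _ _ H).
have [|||s Hs] := shrink _ _ _ _ _ v (local_compl_sym w es) (local_compl_irr w ei)
  _ _ _ (local_map_step w es ei H).
- rewrite (eq_card (B := z)) // => u; rewrite !unfold_in.
  by have [->|] := eqVneq u w; rewrite ?xw addbF.
- by have [vw'|] := eqVneq v w; rewrite ?zv //; rewrite vw' ei in vw.
- by rewrite xv zv es vw.
by exists (w :: s).
Qed.

End LocalComplementation.

(** * Self-complementary symmetric graphs are conference graphs *)

Section ConferenceGraph.
Variable T : finType.
Implicit Types e f : rel T.

(* The diagonal value [codegree e v v] is the degree of [v]. *)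
Definition codegree e (v w : T) := #|[pred u | e v u && e w u]|.

Lemma card_sum (P : pred T) : #|P| = \sum_u (P u : nat).
Proof. by rewrite -sum1_card big_mkcond; apply: eq_bigr => u _. Qed.

Lemma codegree_iso e f (g : T -> T) v w : bijective g ->
  (forall a b, f (g a) (g b) = e a b) -> codegree f (g v) (g w) = codegree e v w.
Proof.
move=> bg fg; rewrite /codegree -[LHS](on_card_preimset (f := g)); last exact: onW_bij.
by apply: eq_card => u; rewrite !inE /= !fg.
Qed.

Lemma codegreeC e v w : codegree e v w = codegree e w v.
Proof. by apply: eq_card => u; rewrite !inE andbC. Qed.

(** A neighbour of [v] is a non-neighbour of [w], a neighbour of [w], or [w] itself; the last case
    contributes [e v w]. *)
Lemma card_edge_nonedge e v w : irreflexive e ->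
  #|[pred u | e v u && graph_compl e w u]| + codegree e v w + e v w
  = codegree e v v.
Proof.
move=> ei.
have -> : e v w = \sum_u (e v u && (u == w) : nat) :> nat.
  rewrite (bigD1 w) //= eqxx andbT big1 ?addn0 // => u /negPf ->.
  by rewrite andbF.
rewrite /codegree !card_sum -!big_split; apply: eq_bigr => u _.
rewrite /= /graph_compl (eq_sym w).
by have [->|_] := eqVneq u w; rewrite ?ei; case: (e v _) => //=; case: (e w u).
Qed.

Lemma graph_complK e : irreflexive e -> graph_compl (graph_compl e) =2 e.
Proof.
by move=> ei a b; rewrite /graph_compl; have [->|_] := eqVneq; rewrite /= ?negbK ?ei.
Qed.

Lemma codegreeE e v w : codegree e v w = \sum_u (e v u && e w u : nat).
Proof. exact: card_sum. Qed.

Lemma degreeE e v : codegree e v v = \sum_u (e v u : nat).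
Proof. by rewrite codegreeE; under eq_bigr do rewrite andbb. Qed.

Lemma degree_compl e v : irreflexive e ->
  codegree e v v + codegree (graph_compl e) v v + 1 = #|T|.
Proof.
move=> ei; rewrite -(card1 v) !card_sum !degreeE -!big_split /=; apply: eq_bigr => u _.
by rewrite /graph_compl eq_sym; have [->|_] := eqVneq; rewrite ?ei //; case: (e v u).
Qed.

(** Adding [e v w] as 0 or 1 merges the codegrees m - 1 and m of adjacent and non-adjacent pairs; m
    = 0 is the single vertex. *)
Definition conference_graph e m :=
  [/\ #|T| = 4 * m + 1, forall v, codegree e v v = 2 * m
    & forall v w, v != w -> codegree e v w + e v w = m].

(** Transitivity makes the degree k and the codegree l of adjacent pairs constant, and the
    isomorphism carries both to the complement. Unless k = 0, m = l + 1. *)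
Lemma conference_graph_self_complementary e :
    symmetric e -> irreflexive e -> 0 < #|T| -> self_complementary e ->
    symmetric_graph e -> exists m, conference_graph e m.
Proof.
move=> es ei /card_gt0P[v0 _] [h bh hc] [vt et].
have [k Hk] : exists k, forall v, codegree e v v = k.
  exists (codegree e v0 v0) => v; have [g [bg ge] <-] := vt v0 v.
  exact: codegree_iso.
have Hkc v : codegree (graph_compl e) v v = k.
  have [h' _ h'K] := bh; rewrite -(h'K v) -(Hk (h' v)).
  exact: codegree_iso.
have [l Hl] : exists l, forall v w, e v w -> codegree e v w = l.
  have [/existsP[a /existsP[b eab]]|/existsPn no] :=
    boolP [exists a, exists b, e a b].
    exists (codegree e a b) => v w evw.
    have [g [bg ge] gE] := et _ _ _ _ eab evw.
    rewrite -(codegree_iso a b bg ge).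
    have [] : v \in [set g a; g b] /\ w \in [set g a; g b].
      by rewrite gE !inE !eqxx orbT.
    have vw : v != w by apply: contraTneq evw => ->; rewrite ei.
    rewrite !inE => /orP[]/eqP vE /orP[]/eqP wE;
      by [rewrite vE wE eqxx in vw | rewrite vE wE // codegreeC].
  by exists 0 => v w evw; have /existsPn/(_ w) := no v; rewrite evw.
have Hlc v w : graph_compl e v w -> codegree (graph_compl e) v w = l.
  have [h' _ h'K] := bh; rewrite -(h'K v) -(h'K w) hc => /Hl <-.
  exact: codegree_iso.
have Hn : #|T| = 2 * k + 1.
  by have := degree_compl v0 ei; rewrite Hk Hkc; lia.
(* Count the neighbours of [v] adjacent to [w] in the complement, once from [e] and once from the
   complement. *)
have Hmu v w : v != w -> ~~ e v w -> codegree e v w = l.+1.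
  move=> vw nevw; have cwv : graph_compl e w v by rewrite /graph_compl eq_sym vw es.
  have := card_edge_nonedge v w ei.
  have ci : irreflexive (graph_compl e) by move=> a; rewrite /graph_compl eqxx.
  have := card_edge_nonedge w v ci; rewrite Hlc // cwv Hkc Hk (negPf nevw).
  rewrite (eq_card (B := [pred u | e v u && graph_compl e w u])) /=.
    by move: #|_| => c; lia.
  by move=> u; rewrite !inE graph_complK // andbC.
(* Walks of length 2 from [v0], counted by middle vertex and by end vertex. *)
have kk : k * k = k + k * l + k * l.+1.
  transitivity (\sum_w codegree e v0 w).
    under eq_bigr do rewrite codegreeE.
    rewrite exchange_big /= -[X in X * _](Hk v0) degreeE big_distrl /=.
    apply: eq_bigr => u _; rewrite -[X in _ * X](Hk u) degreeE big_distrr /=.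
    by apply: eq_bigr => w _; rewrite (es u) mulnb.
  have -> : k + k * l + k * l.+1 = 1 * k + codegree e v0 v0 * l
      + codegree (graph_compl e) v0 v0 * l.+1 by rewrite Hk Hkc mul1n.
  rewrite -(card1 v0) card_sum !degreeE !big_distrl -!big_split /=.
  apply: eq_bigr => w _.
  rewrite /graph_compl (eq_sym v0).
  have [->|wv] := eqVneq w v0; first by rewrite Hk ei /=; lia.
  case evw: (e v0 w) => /=; first by rewrite Hl //; lia.
  by rewrite Hmu ?evw 1?eq_sym //; lia.
have [k0|k_gt0] := posnP k.
  exists 0; split=> [|v|v w vw]; rewrite ?Hk ?k0 ?Hn ?k0 //.
  have /card_le1_eqP/(_ v w) : #|T| <= 1 by rewrite Hn k0.
  by move=> E; rewrite E ?eqxx in vw.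
have {kk} kl : k = 2 * l.+1 by nia.
exists l.+1; split=> [|v|v w vw]; rewrite ?Hk ?Hn //; first by lia.
have [evw|nevw] := boolP (e v w); first by rewrite Hl // addn1.
by rewrite Hmu // addn0.
Qed.

End ConferenceGraph.

(** * The two parities of m *)

Lemma odd_card_bigop (T : finType) (P : pred T) :
  \big[addb/false]_u P u = odd #|P|.
Proof.
rewrite card_sum (big_morph odd oddD (erefl : odd 0 = false)).
by apply: eq_bigr => u _; rewrite oddb.
Qed.

Lemma conference_graph_codegree_odd (T : finType) (e : rel T) m v w :
    irreflexive e -> conference_graph e m ->
  odd (codegree e v w) = (odd m && (v != w)) (+) e v w.
Proof.
move=> ei [_ H2 H3]; have [<-|vw] := eqVneq v w; first by rewrite H2 ei andbF; lia.
by rewrite -(H3 _ _ vw) oddD oddb andbT -addbA addbb addbF.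
Qed.

(* With A + A^2 = I + J over GF(2), X = Z = T = I and Y = 0 work. *)
Lemma conference_graph_odd (T : finType) (e : rel T) m :
    symmetric e -> irreflexive e -> conference_graph e m -> odd m ->
  in_compl_class e (graph_compl e).
Proof.
move=> es ei He om.
have ci : irreflexive (graph_compl e) by move=> a; rewrite /graph_compl eqxx.
apply: (local_map_in_class (x := xpredT) (y := xpred0)
  (z := xpredT) (t := xpredT)) => //.
split=> // c w /=; rewrite addbF.
(* Since B + I = A + J, the sum is an entry of AJ + A^2; the repeated factor turns a row sum of A
   into [codegree e w w]. *)
rewrite (eq_bigr (fun u => (e w u && e w u) (+) (e w u && e c u))); last first.
  move=> u _; rewrite /graph_compl (es c).
  by have [->|_] := eqVneq u c; rewrite ?ei; case: (e w _) => //=; rewrite addbF.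
rewrite big_split /= !odd_card_bigop !(conference_graph_codegree_odd _ _ ei He).
rewrite eqxx ei om /graph_compl.
by have [->|_] := eqVneq; rewrite ?ei //; case: (e w c).
Qed.

(* Here A^2 = A. The diagonal of the system gives Y = 0, hence X = T = I and
   A Z B = I + J; multiplying by A on the left gives A = I + J. *)
Lemma conference_graph_even (T : finType) (e : rel T) m :
    symmetric e -> irreflexive e -> conference_graph e m -> ~~ odd m ->
  in_compl_class e (graph_compl e) -> m = 0.
Proof.
move=> es ei He em [s Hs].
have [x [y [z [t [D E]]]]] := local_map_word s es ei.
have codeg v w : odd (codegree e v w) = e v w.
  by rewrite (conference_graph_codegree_odd _ _ ei He) (negPf em).
have AB0 c u : e c u && (z u && graph_compl e u c) = false.
  by rewrite /graph_compl (es c); case: (e u c); rewrite ?andbF.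
have y0 w : y w = false.
  have := E w w; rewrite -Hs /graph_compl eqxx andbF andbT big1 ?addbF //= => u _.
  rewrite -Hs; have [->|uw] := eqVneq u w; first by rewrite ei.
  by rewrite andbF addbF AB0.
have xt w : x w /\ t w by apply/andP; have := D w; rewrite y0 addbF.
(* Off the diagonal the system reads B + A Z B = A, and A + B = I + J. *)
have AZB c w : \big[addb/false]_u (e w u && (z u && graph_compl e u c)) = (w != c).
  have [->|wc] := eqVneq w c; first by apply: big1 => u _; exact: AB0.
  have := E c w; have [-> _] := xt w; rewrite y0 -Hs /graph_compl wc addbF /=.
  rewrite (eq_bigr (fun u => (e w u && (z u && graph_compl e u c))
                            (+) ((u == c) && e w c))).
    rewrite big_split /= [X in _ (+) (_ (+) X)](bigD1 c) //= eqxx.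
    rewrite [X in e w c (+) X]big1.
      by case: (e w c); case: (\big[_/_]_u _).
    by move=> u /negPf ->.
  move=> u _; rewrite -Hs; have [_ ->] := xt u.
  by have [->|_] := eqVneq u c; case: (e w _) => //=; rewrite ?addbF.
have complete w c : e w c = (w != c).
  (* A = A (I + J) because AJ = 0; then A (A Z B) = A^2 Z B = A Z B. *)
  transitivity (\big[addb/false]_v (e w v && (v != c))).
    rewrite (eq_bigr (fun v => (e w v && e w v) (+) ((v == c) && e w c))).
      rewrite big_split /= odd_card_bigop codeg ei (bigD1 c) //= eqxx big1 ?addbF //.
      by move=> u /negPf ->.
    by move=> u _; have [->|_] := eqVneq; case: (e w _).
  under eq_bigr do rewrite -AZB big_distrr /=.
  rewrite exchange_big /= -AZB; apply: eq_bigr => u _.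
  under eq_bigr do rewrite andbA (es _ u).
  by rewrite -big_distrl /= odd_card_bigop codeg.
have [Tm H2 _] := He.
have /card_gt0P[v _] : 0 < #|T| by rewrite Tm addn1.
(* The complement has no edges, so 2m + 0 + 1 = 4m + 1. *)
have := degree_compl v ei; rewrite Tm H2 /codegree eq_card0; first by lia.
by move=> u; rewrite !inE /graph_compl complete andbb; case: eqP.
Qed.

Theorem theorem1p7p12 (T : finType) (e : rel T)
    (e_sym : symmetric e) (e_irr : irreflexive e)
    (p r : nat) (p_prime : prime p) (card_T : #|T| = p ^ r)
    (e_sc : self_complementary e) (e_symm : symmetric_graph e) :
  in_compl_class e (graph_compl e) <-> (#|T| = 1 \/ #|T| = 5 %[mod 8]).
Proof.
have T0 : 0 < #|T| by rewrite card_T expn_gt0 prime_gt0.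
have [m Hm] := conference_graph_self_complementary e_sym e_irr T0 e_sc e_symm.
have [Tm _ _] := Hm; split=> [cl | [T1 | T5]].
(* 4m + 1 is 5 modulo 8 exactly when m is odd. *)
- have [om|em] := boolP (odd m); first by right; rewrite Tm; lia.
  by left; rewrite Tm (conference_graph_even e_sym e_irr Hm em cl).
- exists [::] => a b; have /card_le1_eqP E : #|T| <= 1 by rewrite T1.
  by rewrite (E a b) //= /graph_compl eqxx e_irr.
- by apply: (conference_graph_odd e_sym e_irr Hm); rewrite Tm in T5; lia.
Qed.
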